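(* For every $1\neq w\in F_2$, every integer $n\geq32\ell(w)$ and every prime $p$, $$\tau_{w,\mathrm{GL}_n(\mathbb{F}_p)}(e)\leq|\mathrm{GL}_n(\mathbb{F}_p)|^{-\frac{1}{11\ell(w)}}.$$
   Context: $F_2$ is the free group on $x,y$; $\ell(w)$ is the length of the reduced word $w$. For a finite group $G$, $w_G:G^2\to G$ is evaluation and $\tau_{w,G}(g)=|w_G^{-1}(g)|/|G|^2$ is the word measure (pushforward of the uniform measure on $G^2$). *)

(* Defs.v *)
From mathcomp Require Import all_boot all_order all_algebra all_fingroup.
From Stdlib Require Import Reals.
Set Implicit Arguments. Unset Strict Implicit. Unset Printing Implicit Defensive.

(* Letters of the free group F_2 on x, y:
   a letter is (gen, inv) with gen = false for x, true for y,
   inv = true meaning the inverse of the generator. *)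
Definition letter := (bool * bool)%type.

Fixpoint reduced (w : seq letter) : bool :=
  match w with
  | a :: ((b :: _) as t) => ~~ ((a.1 == b.1) && (a.2 != b.2)) && reduced t
  | _ => true
  end.

(* Elements of F_2 are reduced words; the identity is the empty word,
   and the length ell(w) of a reduced word is size w. *)
Definition F2 := {w : seq letter | reduced w}.
Definition ell (w : F2) : nat := size (sval w).

Definition eval_letter (gT : finGroupType) (gh : gT * gT) (a : letter) : gT :=
  let z := if a.1 then gh.2 else gh.1 in if a.2 then invg z else z.

Definition word_map (gT : finGroupType) (w : F2) (gh : gT * gT) : gT :=
  foldr (fun a acc => (eval_letter gh a * acc)%g) 1%g (sval w).

Definition word_measure (gT : finGroupType) (w : F2) (g : gT) : R :=
  (INR #|[set gh : gT * gT | word_map w gh == g]| / (pow (INR #|gT|) 2))%R.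

(* Main.v *)
(* If [w(g,h) = 1], every vector [v] is fixed by [w(g,h)]. Expose [g] and [h]
   only along the trajectories of [k] vectors under the letters of [w], each
   starting outside the span of all vectors met before. A new image is uniform
   outside the range already exposed, and since [w] is reduced a trajectory can
   close only if some image falls into the span of the earlier vectors, which
   has dimension at most [k (l + 1)], [l] being the length of [w]. So each of
   the [k] trajectories closes with conditional probability at most [q^-m], for
   [m = n - k (l + 1) - l]. With [k = n / (4 l)] the resulting bound [q^-(m k)]
   suffices, because [|GL_n| <= q^(n^2)] and [n^2 <= 11 l m k]. *)
Require Import Defs.
From mathcomp Require Import all_boot all_order all_algebra all_fingroup.
From mathcomp Require Import zify.

Set Implicit Arguments. Unset Strict Implicit. Unset Printing Implicit Defensive.

(** * Letters, words, and changing the value of one letter *)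

Section Letters.
Variable gT : finGroupType.
Implicit Types (gh : gT * gT) (a c : letter) (z : gT).

Definition letter_inv a : letter := (a.1, ~~ a.2).

Lemma letter_invK : involutive letter_inv.
Proof. by case=> i b; rewrite /letter_inv /= negbK. Qed.

Lemma letter_inv_neq a : (letter_inv a == a) = false.
Proof. by case: a => [[] []]. Qed.

Lemma eval_letter_inv gh a : eval_letter gh (letter_inv a) = (eval_letter gh a)^-1%g.
Proof. by case: a => [[] []]; rewrite /eval_letter /= ?invgK. Qed.

Definition eval_word (u : seq letter) gh : gT :=
  foldr (fun a acc => (eval_letter gh a * acc)%g) 1%g u.

Definition set_letter gh a z : gT * gT :=
  let z' := if a.2 then (z^-1)%g else z in
  if a.1 then (gh.1, z') else (z', gh.2).

Lemma eval_set_letter gh a z c :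
  eval_letter (set_letter gh a z) c =
    if c == a then z else if c == letter_inv a then (z^-1)%g else eval_letter gh c.
Proof.
by case: a c => [[] []] [[] []]; rewrite /eval_letter /set_letter /= ?invgK.
Qed.

Lemma set_letter_set gh a z z' :
  set_letter (set_letter gh a z) a z' = set_letter gh a z'.
Proof. by case: a => [[] []]. Qed.

Lemma set_letter_eval gh a : set_letter gh a (eval_letter gh a) = gh.
Proof. by case: gh a => [g h] [[] []]; rewrite /set_letter /eval_letter /= ?invgK. Qed.

End Letters.

(** * Linear functionals *)

Section Transvection.
Import GRing.Theory.
Local Open Scope ring_scope.
Variables (F : finFieldType) (n : nat).

(** Each vector has a nonzero coordinate; if neither coordinate serves both vectors, the sum of the
    two does. *)
Lemma common_nonzero_functional (a b : 'rV[F]_n) :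
  a != 0 -> b != 0 ->
  exists f : 'cV[F]_n, (a *m f) 0 0 != 0 /\ (b *m f) 0 0 != 0.
Proof.
have coordE (c : 'rV[F]_n) i : (c *m delta_mx i 0 : 'M_1) 0 0 = c 0 i.
  rewrite mxE (bigD1 i) //= mxE !eqxx mulr1 big1 ?addr0 // => j /negPf ji.
  by rewrite mxE ji mulr0.
move=> /rV0Pn[i ai] /rV0Pn[j bj].
have [bi|] := eqVneq (b 0 i) 0; last by exists (delta_mx i 0); rewrite !coordE.
have [aj|] := eqVneq (a 0 j) 0; last by exists (delta_mx j 0); rewrite !coordE.
exists (delta_mx i 0 + delta_mx j 0); rewrite !mulmxDr.
rewrite [X in X != 0 /\ _]mxE [X in _ /\ X != 0]mxE !coordE.
by rewrite aj bi addr0 add0r.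
Qed.

End Transvection.

(** * Transvections and row spaces over a finite field *)

Section GL.
Import GRing.Theory.
Local Open Scope ring_scope.
Variables (F : finFieldType) (n : nat).
Local Notation V := 'rV[F]_n.+1.
Local Notation G := {'GL_n.+1[F]}.
Local Notation q := #|F|.
Local Notation "A *g z" := (A *m GLval (z : G)) (at level 40, left associativity).

Lemma mulmx_GLM (m : nat) (A : 'M[F]_(m, n.+1)) (z t : G) : A *g (z * t)%g = A *g z *g t.
Proof. exact: mulmxA. Qed.

Lemma mulmx_GL1 (m : nat) (A : 'M[F]_(m, n.+1)) : A *g 1%g = A.
Proof. exact: mulmx1. Qed.

Lemma mulmx_GLK (m : nat) (A : 'M[F]_(m, n.+1)) (z : G) : A *g z *g z^-1%g = A.
Proof. by rewrite -mulmx_GLM mulgV mulmx_GL1. Qed.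

(* The transvection [1 + f (y' - y)], where the functional [f] vanishes on [U],
   equals 1 at [y] and is nonzero at [y']. *)
Lemma transvection_fixing d (U : 'M[F]_(d, n.+1)) (y y' : V) :
  ~~ (y <= U)%MS -> ~~ (y' <= U)%MS ->
  exists t : G, U *g t = U /\ y *g t = y'.
Proof.
rewrite !submxE => yU y'U.
have [g [g1 g2]] := common_nonzero_functional yU y'U.
set s := (_ *m g) 0 0 in g1.
set s' := (_ *m g) 0 0 in g2.
pose f : 'cV_n.+1 := s^-1 *: (cokermx U *m g).
have Uf : U *m f = 0 by rewrite -scalemxAr mulmxA mulmx_coker mul0mx scaler0.
have yf : y *m f = 1%:M.
  by rewrite -scalemxAr mulmxA [_ *m g]mx11_scalar -/s scale_scalar_mx mulVf.
have y'f : y' *m f = (s^-1 * s')%:M.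
  by rewrite -scalemxAr mulmxA [_ *m g]mx11_scalar -/s' scale_scalar_mx.
set e := s^-1 * s' in y'f.
have e0 : e != 0 by rewrite mulf_neq0 ?invr_eq0.
pose h := f *m (y' - y).
have hh : h *m h = (e - 1) *: h.
  rewrite mulmxA -(mulmxA f) mulmxBl y'f yf -raddfB mul_mx_scalar.
  by rewrite -scalemxAl.
have MU : 1%:M + h \in unitmx.
  have : (1%:M + h) *m (1%:M - e^-1 *: h) = 1%:M.
    rewrite mulmxDl mul1mx mulmxBr mulmx1 -scalemxAr hh scalerA.
    rewrite mulrBr mulVf // mulr1 scalerBl scale1r.
    by rewrite subKr subrK.
  by case/mulmx1_unit.
exists (FinRing.Unit MU : G); split => /=.
  by rewrite mulmxDr mulmx1 mulmxA Uf mul0mx addr0.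
by rewrite mulmxDr mulmx1 mulmxA yf mul1mx addrC subrK.
Qed.

Lemma card_row_space_le s (S : 'M[F]_(s, n.+1)) :
  (#|[set y : V | (y <= S)%MS]| <= q ^ s)%N.
Proof.
have -> : (q ^ s = #|[set: 'rV[F]_s]|)%N by rewrite cardsT card_mx mul1n.
apply: leq_trans (leq_imset_card (fun u : 'rV[F]_s => u *m S) [set: 'rV[F]_s]).
apply/subset_leq_card/subsetP => y; rewrite inE => /submxP[u ->].
by apply: imset_f.
Qed.

(** * Exposing a pair of matrices along trajectories *)

Implicit Types (a c : letter) (x y v : V) (gh : G * G).

(* Pairs whose letters act in a prescribed way on finitely many vectors:
   [a] maps row [i] of [E a] to row [i] of [E (letter_inv a)]. *)
Definition constrained d (E : letter -> 'M[F]_(d, n.+1)) : {set G * G} :=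
  [set gh | [forall a, E a *g eval_letter gh a == E (letter_inv a)]].

(** Records that [a] sends [x] to [y] and its inverse [y] to [x]. The other letters get a zero row,
    which imposes nothing and keeps the row counts equal. *)
Definition add_constraint d (E : letter -> 'M[F]_(d, n.+1)) a x y c :
    'M[F]_(d + 1, n.+1) :=
  col_mx (E c) (if c == a then x else if c == letter_inv a then y else 0).

Lemma constrainedP d (E : letter -> 'M[F]_(d, n.+1)) gh :
  reflect (forall a, E a *g eval_letter gh a = E (letter_inv a))
          (gh \in constrained E).
Proof. by rewrite inE; apply: (iffP forallP) => H a; apply/eqP. Qed.

Lemma constrained_add d (E : letter -> 'M[F]_(d, n.+1)) a x y :
  constrained (add_constraint E a x y) =
    [set gh in constrained E | x *g eval_letter gh a == y].
Proof.
apply/setP => gh; rewrite inE.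
apply/constrainedP/andP => [H | [/constrainedP H /eqP xy] c].
  split.
    by apply/constrainedP => c; have := H c; rewrite mul_col_mx => /eq_col_mx[].
  have := H a; rewrite mul_col_mx => /eq_col_mx[_].
  by rewrite letter_inv_neq !eqxx => ->.
rewrite /add_constraint mul_col_mx H; congr col_mx.
have [->|ca] := eqVneq c a; first by rewrite letter_inv_neq eqxx.
have [->|ca'] := eqVneq c (letter_inv a).
  by rewrite letter_invK eqxx eval_letter_inv -xy mulmx_GLK.
rewrite (inv_eq letter_invK) (negPf ca') (inj_eq (inv_inj letter_invK)).
by rewrite (negPf ca) mul0mx.
Qed.

Lemma constrained_image_notin d (E : letter -> 'M[F]_(d, n.+1)) a x gh :
  gh \in constrained E -> ~~ (x <= E a)%MS ->
  ~~ (x *g eval_letter gh a <= E (letter_inv a))%MS.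
Proof.
move=> /constrainedP ghE; apply: contra.
move=> /(submxMr (GLval (eval_letter gh (letter_inv a)))).
by rewrite ghE letter_invK eval_letter_inv mulmx_GLK.
Qed.

(** Multiplying the value of [a] by a transvection that fixes the exposed range and sends [y] to
    [y'] is injective on pairs. By symmetry all images outside that range are equally likely. *)
Lemma card_constrained_add_le d (E : letter -> 'M[F]_(d, n.+1)) a x y y' :
  ~~ (y <= E (letter_inv a))%MS -> ~~ (y' <= E (letter_inv a))%MS ->
  (#|constrained (add_constraint E a x y)| <=
   #|constrained (add_constraint E a x y')|)%N.
Proof.
move=> yE y'E; have [t [tE ty]] := transvection_fixing yE y'E.
pose phi gh := set_letter gh a (eval_letter gh a * t)%g.
have phi_inj : injective phi.
  apply: (can_inj (g := fun gh => set_letter gh a (eval_letter gh a * t^-1)%g)).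
  move=> gh; rewrite /phi set_letter_set eval_set_letter eqxx mulgK.
  exact: set_letter_eval.
rewrite -(card_imset _ phi_inj); apply/subset_leq_card/subsetP => _ /imsetP[gh ghE ->].
move: ghE; rewrite !constrained_add !inE => /andP[/forallP H /eqP xy].
rewrite eval_set_letter eqxx mulmx_GLM xy ty eqxx andbT.
apply/forallP => c; rewrite eval_set_letter.
have [->|ca] := eqVneq c a; first by rewrite mulmx_GLM (eqP (H a)) tE.
have [->|_] := eqVneq c (letter_inv a); last exact: H.
rewrite letter_invK invMg mulmx_GLM -{1}tE mulmx_GLK.
by rewrite -eval_letter_inv (eqP (H _)) letter_invK.
Qed.

Lemma card_constrained_split d (E : letter -> 'M[F]_(d, n.+1)) a x (W : {set G * G}) :
  ~~ (x <= E a)%MS ->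
  #|constrained E :&: W| =
    (\sum_(y | ~~ (y <= E (letter_inv a))%MS)
       #|constrained (add_constraint E a x y) :&: W|)%N.
Proof.
move=> xE; rewrite -sum1_card.
rewrite (partition_big (fun gh => x *g eval_letter gh a)
           (fun y => ~~ (y <= E (letter_inv a))%MS)) /=.
  apply: eq_bigr => y _; rewrite -sum1_card; apply: eq_bigl => gh.
  by rewrite constrained_add !inE -!andbA; congr andb; rewrite andbC.
by move=> gh; rewrite inE => /andP[ghE _]; apply: constrained_image_notin.
Qed.

(** The image of [x] is uniform outside the exposed range [U], so it falls into [S] with probability
    [(|S| - |U|) / (q^n.+1 - |U|)], at most [q^s / q^n.+1]. If [U] is the whole space, the sum is
    empty. *)
Lemma card_coincidence d (E : letter -> 'M[F]_(d, n.+1)) s (S : 'M[F]_(s, n.+1)) a x :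
  ~~ (x <= E a)%MS -> (E (letter_inv a) <= S)%MS ->
  (q ^ n.+1 * \sum_(y | ~~ (y <= E (letter_inv a))%MS && (y <= S)%MS)
     #|constrained (add_constraint E a x y)| <= q ^ s * #|constrained E|)%N.
Proof.
move=> xE ES.
have [allU|] := boolP [forall y : V, (y <= E (letter_inv a))%MS].
  by rewrite big_pred0 ?muln0 // => y; rewrite (forallP allU).
rewrite negb_forall => /existsP[y0 y0E].
set c := #|constrained (add_constraint E a x y0)|.
have fibE y : ~~ (y <= E (letter_inv a))%MS ->
    #|constrained (add_constraint E a x y)| = c.
  by move=> yE; apply/eqP; rewrite eqn_leq !card_constrained_add_le.
have -> : #|constrained E| = (#|[set y : V | ~~ (y <= E (letter_inv a))%MS]| * c)%N.
  rewrite -[constrained E]setIT (card_constrained_split setT xE).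
  rewrite -sum_nat_const; under [in RHS]eq_bigl => y do rewrite inE.
  by apply: eq_bigr => y yE; rewrite setIT fibE.
under eq_bigr => y /andP[yE _] do rewrite fibE //.
set U := [set y : V | (y <= E (letter_inv a))%MS].
set SS := [set y : V | (y <= S)%MS].
have US : U \subset SS.
  by apply/subsetP => y; rewrite !inE => /submx_trans; apply.
have -> : [set y : V | ~~ (y <= E (letter_inv a))%MS] = ~: U.
  by apply/setP => y; rewrite !inE.
rewrite (eq_bigl (mem (SS :\: U))) => [|y]; last by rewrite /= !inE.
rewrite sum_nat_const.
have cardV : (q ^ n.+1 = #|[set: V]|)%N by rewrite cardsT card_mx mul1n.
rewrite cardsD (setIidPr US) -[~: U]setTD cardsD (setIidPr (subsetT U)) -cardV.
have := card_row_space_le S; rewrite -/SS.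
have := subset_leq_card (subsetT SS); rewrite -cardV.
have := subset_leq_card US.
set N := (q ^ n.+1)%N; set M := (q ^ s)%N => *.
rewrite !mulnA leq_mul2r; apply/orP; right.
nia.
Qed.

(* Exposing one trajectory: [x] is its current end, [u] the remaining letters,
   [S] spans all vectors met so far. At a coincidence the exposure stops, and
   the count is bounded by the assumption on [W]; without one, the end of the
   trajectory is a vector outside the span of the earlier ones, hence not [v]. *)
Lemma card_closed_trajectory (W : {set G * G}) (v : V) (B Q : nat)
    (Wbound : forall d (E : letter -> 'M[F]_(d, n.+1)) s (S : 'M[F]_(s, n.+1)),
       (s <= B)%N -> (forall c, (E c <= S)%MS) ->
       (#|constrained E :&: W| * Q <= #|constrained E|)%N)
    (u : seq letter) d (E : letter -> 'M[F]_(d, n.+1)) s (S : 'M[F]_(s, n.+1)) x :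
  reduced u -> (s + size u <= B)%N -> (forall c, (E c <= S)%MS) ->
  (x <= S)%MS -> (v <= S)%MS ->
  (if u is a :: _ then ~~ (x <= E a)%MS else x != v) ->
  (q ^ n.+1 * (#|constrained E :&: (W :&: [set gh | x *g eval_word u gh == v])| * Q)
     <= size u * q ^ B * #|constrained E|)%N.
Proof.
have q_gt0 : (0 < q)%N by rewrite (cardD1 0) inE.
elim: u d E s S x => [|a u IH] d E s S x red_u sB ES xS vS xE.
  rewrite (_ : _ :&: _ = set0) ?cards0 ?mul0n ?muln0 //.
  by apply/setP => gh; rewrite !inE mulmx_GL1 (negPf xE) !andbF.
set T := [set gh | _].
have xuE y gh : gh \in constrained (add_constraint E a x y) ->
    (gh \in T) = (y *g eval_word u gh == v).
  rewrite constrained_add !inE => /andP[_ /eqP <-].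
  by rewrite /= mulmx_GLM.
(* The next image [y] either falls into [S], which costs one summand [q ^ B], or enlarges the span
   and leaves the letters of [u]. *)
rewrite (card_constrained_split (W :&: T) xE) (bigID (fun y => (y <= S)%MS)) /=.
rewrite mulnDl mulnDr mulSn [X in (_ <= X)%N]mulnDl leq_add //.
  apply: (@leq_trans (q ^ s * #|constrained E|)); last first.
    by rewrite leq_mul2r leq_pexp2l ?orbT //; apply: leq_trans sB; apply: leq_addr.
  apply: leq_trans (card_coincidence xE (ES _)); rewrite leq_mul2l big_distrl /=.
  apply/orP; right; apply: leq_sum => y /andP[_ yS].
  apply: (@leq_trans (#|constrained (add_constraint E a x y) :&: W| * Q)).
    by rewrite leq_mul2r subset_leq_card ?orbT // setIS ?subsetIl.
  (* Both [x] and [y] lie in [S], so [S] still contains all exposed vectors. *)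
  apply: (Wbound _ _ _ S); first by apply: leq_trans sB; apply: leq_addr.
  move=> c; rewrite /add_constraint -addsmxE addsmx_sub ES /=.
  by case: ifP => // _; case: ifP => // _; rewrite sub0mx.
apply: (@leq_trans (\sum_(y | ~~ (y <= E (letter_inv a))%MS && ~~ (y <= S)%MS)
    size u * q ^ B * #|constrained (add_constraint E a x y)|)); last first.
  rewrite -big_distrr leq_mul2l /=; apply/orP; right.
  rewrite -[constrained E]setIT (card_constrained_split setT xE).
  rewrite [X in (_ <= X)%N](bigID (fun y => (y <= S)%MS)) /=.
  by under [X in (_ <= _ + X)%N]eq_bigr => y _ do rewrite setIT; apply: leq_addl.
rewrite big_distrl big_distrr /=; apply: leq_sum => y /andP[_ yS].
have -> : constrained (add_constraint E a x y) :&: (W :&: T) =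
    constrained (add_constraint E a x y) :&:
      (W :&: [set gh | y *g eval_word u gh == v]).
  apply/setP => gh; rewrite !in_setI; case: (boolP (gh \in constrained _)) => //= H.
  by rewrite (xuE _ _ H) in_set.
have S1 d' (A : 'M[F]_(d', n.+1)) : (A <= S)%MS -> (A <= col_mx S y)%MS.
  by move=> AS; rewrite -addsmxE; apply: submx_trans (addsmxSl _ _).
have yS1 : (y <= col_mx S y)%MS by rewrite -addsmxE addsmxSr.
have ES1 c : (add_constraint E a x y c <= col_mx S y)%MS.
  rewrite {1}/add_constraint -addsmxE addsmx_sub S1 //=.
  by case: ifP => // _; [apply: S1|case: ifP => // _; rewrite sub0mx].
apply: (IH _ _ _ (col_mx S y)) => //.
- by move: red_u; case: (u) => [|b u'] //= /andP[].
- by rewrite addn1 addSnnS.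
- exact: S1.
- case: (u) red_u => [|b u'] /=.
    by move=> _; apply: contra yS => /eqP ->.
  rewrite /add_constraint -addsmxE => /andP[ab _].
  (* Reducedness enters here: as [b] is not inverse to [a], the new row of [E b] is [x] or 0, so [y]
     stays outside its row space. *)
  have /negPf -> : b != letter_inv a.
    by apply: contra ab => /eqP ->; case: (a) => [[] []].
  apply: contra yS => /submx_trans; apply.
  by rewrite addsmx_sub ES; case: ifP => // _; rewrite sub0mx.
Qed.

(** Induction on [k]: a trajectory started outside [S] gains a factor [q ^ m] and adds at most
    [(size w).+1] rows, its start and its images. *)
Lemma card_constrained_kernel (w : seq letter) (m k : nat) d
    (E : letter -> 'M[F]_(d, n.+1)) s (S : 'M[F]_(s, n.+1)) :
  reduced w -> w <> [::] ->
  (s + k * (size w).+1 + size w + m <= n.+1)%N -> (forall c, (E c <= S)%MS) ->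
  (#|constrained E :&: [set gh | eval_word w gh == 1%g]| * q ^ (m * k)
     <= #|constrained E|)%N.
Proof.
move=> red_w w0; have q_gt1 : (1 < q)%N by apply: card_finNzRing_gt1.
elim: k d E s S => [|k IH] d E s S sn ES.
  by rewrite muln0 muln1 subset_leq_card ?subsetIl.
have [v vS] : exists v : V, ~~ (v <= S)%MS.
  apply/existsP; rewrite -negb_forall; apply/negP => /forallP allS.
  have := card_row_space_le S.
  rewrite (_ : [set _ | _] = setT); last by apply/setP => y; rewrite !inE allS.
  by rewrite cardsT card_mx mul1n leq_exp2l //; lia.
set B := (s + (size w).+1)%N.
have vS1 : (v <= col_mx S v)%MS by rewrite -addsmxE addsmxSr.
have ES1 c : (E c <= col_mx S v)%MS.
  by rewrite -addsmxE; apply: submx_trans (ES c) (addsmxSl _ _).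
set W := [set gh | _].
have Wbound d' (E' : letter -> 'M[F]_(d', n.+1)) s' (S' : 'M[F]_(s', n.+1)) :
    (s' <= B)%N -> (forall c, (E' c <= S')%MS) ->
    (#|constrained E' :&: W| * q ^ (m * k) <= #|constrained E'|)%N.
  by move=> s'B; apply: IH; move: sn s'B; rewrite /B; nia.
have /(_ w _ E _ (col_mx S v) v) := card_closed_trajectory (v := v) Wbound.
rewrite {1}addn1 addSnnS leqnn vS1 => /(_ red_w isT ES1 isT isT).
(* On [W] the word acts trivially, so the trajectory of [v] always closes. *)
have -> : W :&: [set gh | v *g eval_word w gh == v] = W.
  apply/setIidPl/subsetP => gh; rewrite !inE => /eqP ->.
  by rewrite mulmx_GL1.
have vE : is_true (if w is a :: _ then ~~ (v <= E a)%MS else v != v).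
  by case: (w) w0 => // a u _; apply: contra vS => /submx_trans; apply.
move=> /(_ vE).
(* The factor [size w] counts the possible places of a coincidence; the summand [size w] in the
   dimension bound absorbs it. *)
have lq : (size w * q ^ B * q ^ m <= q ^ n.+1)%N.
  apply: (@leq_trans (q ^ size w * q ^ B * q ^ m)).
    by rewrite !leq_mul2r ltnW ?orbT // ltn_expl.
  by rewrite -!expnD leq_exp2l //; move: sn; rewrite /B; nia.
have c_gt0 : (0 < size w * q ^ B)%N.
  by rewrite muln_gt0 expn_gt0 (ltnW q_gt1) andbT; case: (w) w0.
move=> H; rewrite -(leq_pmul2l c_gt0); apply: leq_trans H.
rewrite [X in (X <= _)%N](_ : _ =
  size w * q ^ B * q ^ m * (#|constrained E :&: W| * q ^ (m * k)))%N.
  exact: leq_mul.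
by rewrite mulnS expnD; lia.
Qed.

Lemma card_word_kernel (w : seq letter) (m k : nat) :
  reduced w -> w <> [::] -> (k * (size w).+1 + size w + m <= n.+1)%N ->
  (#|[set gh : G * G | eval_word w gh == 1%g]| * q ^ (m * k) <= #|{: G}| ^ 2)%N.
Proof.
move=> red_w w0 kn.
(* Matrices without rows constrain nothing, so all pairs are counted. *)
have := @card_constrained_kernel w m k 0 (fun=> 0) 0 0 red_w w0 kn.
rewrite (_ : constrained _ = setT).
  by rewrite setTI cardsT card_prod; apply=> c; rewrite sub0mx.
by apply/setP => gh; rewrite in_setT; apply/constrainedP => a; rewrite mul0mx.
Qed.

Lemma card_GL_le : (#|{: G}| <= q ^ (n.+1 ^ 2))%N.
Proof.
rewrite -[(_ ^ _)%N]/(q ^ (n.+1 * n.+1))%N -(card_mx F) -(card_codom (@val_inj _ _ G)).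
exact: max_card.
Qed.

End GL.

(* Imported only here because [Reals] rebinds [^] on [nat] to [Nat.pow]. *)
From Stdlib Require Import Reals Lra.

(** * Passage to real exponents *)

Lemma INR_expn (q b : nat) : INR (expn q b) = pow (INR q) b.
Proof. by elim: b => // b IH; rewrite expnS mult_INR IH. Qed.

(** Both sides are compared with [q^-b]: the second bound gives [N^(1/a) <= q^b]. *)
Lemma ratio_le_Rpower (c N q a b : nat) :
  (0 < N)%N -> (0 < q)%N -> (0 < a)%N ->
  (c * expn q b <= expn N 2)%N -> (N <= expn q (a * b))%N ->
  (INR c / pow (INR N) 2 <= Rpower (INR N) (- (1 / INR a)))%R.
Proof.
move=> /ltP/lt_0_INR N0 /ltP/lt_0_INR q0 /ltP/lt_0_INR a0.
move=> /leP/le_INR; rewrite mult_INR !INR_expn => cN.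
move=> /leP/le_INR; rewrite INR_expn => NQ.
have qb0 := pow_lt _ b q0.
have N20 := pow_lt _ 2 N0.
apply: (Rle_trans _ (/ pow (INR q) b)).
  apply: (Rmult_le_reg_r (pow (INR q) b)) => //.
  apply: (Rmult_le_reg_r (pow (INR N) 2)) => //.
  by rewrite Rinv_l; [field_simplify; lra|lra].
rewrite Rpower_Ropp; apply: Rinv_le_contravar; first exact: exp_pos.
apply: (Rle_trans _ (Rpower (pow (INR q) (a * b)) (1 / INR a))).
  apply: Rle_Rpower_l; last by split.
  by apply/Rlt_le/Rdiv_lt_0_compat; lra.
rewrite -Rpower_pow // Rpower_mult mult_INR.
rewrite (_ : _ * _ * _ = INR b)%R; last by field; lra.
by rewrite Rpower_pow //; apply: Rle_refl.
Qed.

(** * Choice of the parameters *)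

Theorem theorem3p12 :
  forall (w : F2) (n p : nat),
    sval w <> [::] ->
    (32 * ell w <= n)%N ->
    prime p ->
    (word_measure w (1%g : {'GL_n['F_p]})
      <= Rpower (INR #|{: {'GL_n['F_p]}}|) (- (1 / (11 * INR (ell w)))))%R.
Proof.
case=> w red_w [|n] p /= w0; rewrite /ell /word_measure /=;
  have l0 : (0 < size w)%N by rewrite lt0n size_eq0; apply/eqP.
  by lia.
move=> nw p_pr.
set k := (n.+1 %/ (4 * size w))%N.
set m := (n.+1 - k * (size w).+1 - size w)%N.
have kn : (k * (4 * size w) <= n.+1)%N by apply: leq_trunc_div.
have kn' : (n.+1 < k.+1 * (4 * size w))%N by apply: ltn_ceil; lia.
have kw : (2 * (k * (size w).+1) <= n.+1)%N by nia.
(* With [N = n.+1] and [l = size w <= N/32]: [m >= N/2 - l >= 15N/32], and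
   [4kl > N - 4l >= 7N/8]. *)
have m_big : (15 * n.+1 <= 32 * m)%N by rewrite /m; lia.
have k_big : (7 * n.+1 <= 32 * (k * size w))%N by nia.
(* The constant 11 suffices because [11 * 15 * 7 = 1155] exceeds [32^2 = 1024]. *)
have expo : (n.+1 * n.+1 <= 11 * size w * (m * k))%N.
  have := leq_mul m_big k_big; nia.
have bound : (k * (size w).+1 + size w + m <= n.+1)%N by rewrite /m; lia.
have p_gt0 : (0 < p)%N by apply: prime_gt0.
have q_eq : #|'F_p| = p by apply: card_Fp.
have := @card_word_kernel 'F_p n w m k red_w w0 bound.
have := @card_GL_le 'F_p n.
rewrite q_eq => GL_le ker_le.
have -> : (11 * INR (size w) = INR (11 * size w))%R.
  by rewrite mult_INR; congr Rmult; rewrite /=; lra.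
apply: (@ratio_le_Rpower _ _ p _ (m * k)) => //.
- by apply/card_gt0P; exists 1%g.
- by rewrite muln_gt0.
- by apply: leq_trans GL_le _; rewrite leq_pexp2l.
Qed.
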